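(* Let $G_t=(V_t,E_t)$, $t\ge 0$, be the sequence of graphs evolved by the clustering attachment (CA) model (without node and edge deletion), and assume that the evolution parameter $m_0$ satisfies $m_0=2$. Let $\overline{C}_t=\frac{1}{\|V_t\|}\sum_{i\in V_t}c_{i,t}$ be the average clustering coefficient of $G_t$. Then for any $t\ge 0$, $$-\frac{3}{\|V_0\|+t+1}\le \overline{C}_t-\overline{C}_{t+1}\le \frac{7/3}{\|V_0\|+t+1}.$$
   Context: Notation: for a finite set $A$, $\|A\|$ is its cardinality. All graphs are finite, undirected and simple; $G_0=(V_0,E_0)$ is a given (non-random) graph with $V_0=\{1,\dots,\|V_0\|\}$. Clustering coefficients: for a node $i\in V_t$ of $G_t=(V_t,E_t)$ let $k_{i,t}$ be its degree and $\Delta_{i,t}$ the number of triangles of $G_t$ containing $i$ (equivalently, the number of edges between neighbours of $i$). Set $c_{i,t}=0$ if $k_{i,t}\in\{0,1\}$ and $c_{i,t}=2\Delta_{i,t}/(k_{i,t}(k_{i,t}-1))$ if $k_{i,t}\ge 2$. CA model with parameters $\alpha\ge 0$, $\epsilon\ge0$ and $m_0=2$, without node and edge deletion: for $t\ge 0$, $G_{t+1}$ is obtained from $G_t$ by (i) appending a new node $\|V_0\|+t+1$; (ii) choosing a set $W_t\subset V_t$ of $m_0=2$ distinct nodes by weighted sampling without replacement with weights $$P_{CA}(i,t)=\frac{c_{i,t}^{\alpha}+\epsilon}{\sum_{j\in V_t}c_{j,t}^{\alpha}+\|V_t\|\epsilon}\ \ (\alpha>0),\qquad P_{CA}(i,t)=\frac{\mathbf{1}\{c_{i,t}>0\}+\epsilon}{\sum_{j\in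 V_t}\mathbf{1}\{c_{j,t}>0\}+\|V_t\|\epsilon}\ \ (\alpha=0),\qquad i\in V_t,$$ and adding the two edges joining the new node to the two nodes of $W_t$. No other changes are made. Thus $V_t=\{1,\dots,\|V_0\|+t\}$. Weighted sampling without replacement of two nodes means: given the graphs up to step $t$, the first node is $i$ with probability $P_{CA}(i,t)$; given that the first node is $i$, the second node is $j\ne i$ with probability $P_{CA}(j,t)/(1-P_{CA}(i,t))$. $W_t$ is the resulting unordered pair. Standing assumption on $G_0$: if $\epsilon>0$, then $\|V_0\|\ge m_0=2$; if $\epsilon=0$, then $\|\tilde V_0\|\ge m_0=2$, where $\tilde V_0=\{i\in V_0: c_{i,0}>0\}$. The inequalities are meant for every realization of the graph sequence. *)

(* Defs.v *)
(* World: MathComp + MathComp-Analysis. *)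
From HB Require Import structures.
From mathcomp Require Import all_boot all_order all_algebra.
From mathcomp Require Import all_classical all_reals all_analysis.

Set Implicit Arguments.
Unset Strict Implicit.
Unset Printing Implicit Defensive.

Import Order.TTheory GRing.Theory Num.Theory.

Local Open Scope ring_scope.

(* Simple undirected graphs on the vertex set {1, ..., n}; the vertex labelled
   k is the ordinal of value k - 1. *)
Record sgraph (n : nat) := SGraph {
  edges : {set {set 'I_n}};
  edges_card2 : [forall e in edges, #|e| == 2%N] }.

HB.instance Definition _ n := [isSub for @edges n].

Section Clustering.
Context {n : nat}.
Implicit Types (G : sgraph n) (i j : 'I_n).

Definition adjacent G i j : bool := ([set i; j] \in edges G)%SET.

Definition degree G i : nat := #|[set j | adjacent G i j]%SET|.

Definition triangles G i : nat :=
  #|[set T : {set 'I_n} | [&& i \in T, #|T| == 3%N &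
      [forall j in T, forall k in T, (j != k) ==> adjacent G j k]]]%SET|.

Definition clustering (R : realType) G i : R :=
  if (degree G i < 2)%N then 0
  else 2 * (triangles G i)%:R / ((degree G i)%:R * ((degree G i)%:R - 1)).

Definition avg_clustering (R : realType) G : R :=
  (\sum_(i < n) clustering R G i) / n%:R.

(* The case split is not redundant: 0 `^ 0 = 1 in the library, whereas a node
   with zero clustering has CA score 0 when alpha = 0. *)
Definition CA_score (R : realType) (alpha : R) G i : R :=
  if alpha == 0 then (0 < clustering R G i)%R%:R
  else clustering R G i `^ alpha.

Definition P_CA (R : realType) (alpha eps : R) G i : R :=
  (CA_score alpha G i + eps) /
  (\sum_(j < n) CA_score alpha G j + n%:R * eps).

Definition CA_initial (R : realType) (eps : R) G : Prop :=
  (0 < eps -> (2 <= n)%N) /\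
  (eps = 0 -> (2 <= #|[set i | (0 < clustering R G i)%R]%SET|)%N).

Definition old_node : 'I_n -> 'I_n.+1 := widen_ord (leqnSn n).

Definition attach_edges G (W : {set 'I_n}) : {set {set 'I_n.+1}} :=
  ([set old_node @: (e : {set 'I_n}) | e in edges G] :|:
   [set [set old_node i; ord_max] | i in W])%SET.

Lemma attach_card2 G (W : {set 'I_n}) :
  [forall e in attach_edges G W, #|e| == 2%N].
Proof.
apply/forall_inP => e; rewrite inE => /orP[] /imsetP[x xP ->].
- have old_inj : injective old_node by move=> a b /(congr1 val) /= /val_inj.
  by rewrite card_imset //; apply: (forall_inP (edges_card2 G)).
- by rewrite cards2 -(inj_eq val_inj) /= (ltn_eqF (ltn_ord x)).
Qed.

(* The new node is [ord_max]; it is joined to every node of W. *)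
Definition attach G (W : {set 'I_n}) : sgraph n.+1 :=
  SGraph (attach_card2 G W).

End Clustering.

(* Since (t.+1 + n0)%N is convertible to (t + n0)%N.+1, the vertex set of G_t
   is 'I_(t + n0) rather than 'I_(n0 + t). *)
Definition graph_process (Omega : Type) (n0 : nat) :=
  forall t : nat, Omega -> sgraph (t + n0).

Definition node_process (Omega : Type) (n0 : nat) :=
  forall t : nat, Omega -> 'I_(t + n0).

Definition history (Omega : Type) (n0 : nat) (G : graph_process Omega n0)
    (g : forall s : nat, sgraph (s + n0)) (t : nat) : set Omega :=
  [set w | forall s, (s <= t)%N -> G s w = g s]%classic.

(* X t and Y t are the first and the second node drawn at step t. The graph
   recursion and X t w != Y t w hold for every outcome w. The conditional
   probabilities given the graphs up to step t are written in product form, so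
   nothing is imposed on histories of probability zero. *)
Record CA_model (R : realType) (d : measure_display) (Omega : measurableType d)
    (P : probability Omega R) (alpha eps : R) (n0 : nat) (G0 : sgraph n0)
    (G : graph_process Omega n0) (X Y : node_process Omega n0) : Prop := {
  CA_start : forall w, G 0%N w = G0;
  CA_distinct : forall t w, X t w != Y t w;
  CA_step : forall t w, G t.+1 w = attach (G t w) [set X t w; Y t w]%SET;
  CA_measurable_first : forall t i, measurable (X t @^-1` [set i])%classic;
  CA_measurable_second : forall t j, measurable (Y t @^-1` [set j])%classic;
  CA_law_first : forall t (g : forall s, sgraph (s + n0)) i,
    P (history G g t `&` X t @^-1` [set i])%classic =
    (P (history G g t) * (P_CA alpha eps (g t) i)%:E)%E;
  CA_law_second : forall t (g : forall s, sgraph (s + n0)) i j, j != i ->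
    P (history G g t `&` X t @^-1` [set i] `&` Y t @^-1` [set j])%classic =
    (P (history G g t `&` X t @^-1` [set i])%classic *
     (P_CA alpha eps (g t) j / (1 - P_CA alpha eps (g t) i))%:E)%E }.

(* Main.v *)
(* Only the new node and the two nodes it is attached to change their clustering
   coefficient. An attached node of degree k >= 2 gains one neighbour and loses
   no triangle, so its coefficient is multiplied by at least (k - 1)/(k + 1) and
   drops by at most 2/(k + 1) <= 2/3. With S_t the sum of the coefficients, this
   gives -3 <= S_t - S_(t+1) <= 4/3; the average adds the term S_t / |V_t|,
   which lies in [0, 1]. *)
Require Import Defs.
From HB Require Import structures.
From mathcomp Require Import all_boot all_order all_algebra.
From mathcomp Require Import all_classical all_reals all_analysis.
From mathcomp Require Import ring lra.

Set Implicit Arguments.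
Unset Strict Implicit.
Unset Printing Implicit Defensive.

Import Order.TTheory GRing.Theory Num.Theory.

Local Open Scope ring_scope.

Lemma triangles_le_bin (n : nat) (G : sgraph n) (i : 'I_n) :
  (triangles G i <= 'C(degree G i, 2))%N.
Proof.
rewrite /degree -cards_draws /triangles.
rewrite -(@card_in_imset _ _ (fun T : {set 'I_n} => (T :\ i)%SET)); last first.
  move=> A B; rewrite !inE => /andP[iA _] /andP[iB _] AB.
  by rewrite -(finset.setD1K iA) AB finset.setD1K.
apply/subset_leq_card/fintype.subsetP => _ /imsetP[T + ->].
rewrite !inE => /and3P[iT /eqP T3 /forall_inP Tadj]; apply/andP; split.
  apply/fintype.subsetP => j; rewrite !inE => /andP[ji jT].
  by move/forall_inP: (Tadj i iT) => /(_ j jT); rewrite eq_sym ji.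
by move: T3; rewrite (finset.cardsD1 i T) iT add1n => -[->].
Qed.

Section ClusteringBounds.
Variables (R : realType) (n : nat).
Implicit Types (G : sgraph n) (i : 'I_n).

Lemma clustering_ge0 G i : 0 <= clustering R G i.
Proof.
rewrite /clustering; case: ltnP => // k2.
by rewrite divr_ge0 ?mulr_ge0 ?subr_ge0 ?ler1n // (leq_trans _ k2).
Qed.

Lemma clustering_le1 G i : clustering R G i <= 1.
Proof.
rewrite /clustering; case: ltnP => // k2.
have k2R : 2 <= (degree G i)%:R :> R by rewrite ler_nat.
rewrite ler_pdivrMr ?mul1r; last by rewrite mulr_gt0 //; lra.
have := triangles_le_bin G i; rewrite -(leq_pmul2l (isT : (0 < 2)%N)).
have -> : (2 * 'C(degree G i, 2) = degree G i * (degree G i).-1)%N.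
  rewrite mul2n bin2 even_halfK //; case: (degree G i) => // k.
  by rewrite oddM /= andNb.
rewrite -(ler_nat R) !natrM => /le_trans; apply.
by rewrite -subn1 natrB // ltnW.
Qed.

Lemma avg_clustering_ge0 G : 0 <= avg_clustering R G.
Proof. by rewrite divr_ge0 // sumr_ge0 // => i _; exact: clustering_ge0. Qed.

Lemma avg_clustering_le1 G : avg_clustering R G <= 1.
Proof.
have sum_le : \sum_(i < n) clustering R G i <= n%:R.
  rewrite -[X in _ <= X%:R]card_ord -sumr_const.
  by apply: ler_sum => i _; exact: clustering_le1.
rewrite /avg_clustering; have [n0|n_gt0] := posnP n.
  by rewrite [X in _ / X%:R]n0 invr0 mulr0.
by rewrite ler_pdivrMr ?ltr0n // mul1r.
Qed.

End ClusteringBounds.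

Section Attach.
Variables (n : nat) (G : sgraph n) (W : {set 'I_n}).
Implicit Types (i j : 'I_n) (A : {set 'I_n}).

Lemma old_node_inj : injective (@old_node n).
Proof. by move=> a b /(congr1 val) /= /val_inj. Qed.

Lemma old_node_neq_max i : old_node i != ord_max.
Proof. by rewrite -(inj_eq val_inj) /= ltn_eqF. Qed.

Lemma max_notin_old_imset A : (ord_max \notin @old_node n @: A)%SET.
Proof.
by apply/imsetP => -[i _ /esym/eqP]; rewrite (negPf (old_node_neq_max i)).
Qed.

Lemma old_or_max (u : 'I_n.+1) : u != ord_max -> exists i, u = old_node i.
Proof.
move=> u_max; have un : (u < n)%N by rewrite ltn_neqAle u_max -ltnS ltn_ord.
by exists (Ordinal un); apply: val_inj.
Qed.

Lemma adjacent_attach_old i j :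
  Defs.adjacent (attach G W) (old_node i) (old_node j) = Defs.adjacent G i j.
Proof.
rewrite /Defs.adjacent /= inE.
rewrite -!(finset.imset_set1 (@old_node n)) -imsetU.
rewrite (mem_imset _ _ (imset_inj old_node_inj)) orbC.
case: imsetP => // -[k kW] /setP/(_ ord_max).
by rewrite (negPf (max_notin_old_imset _)) !inE eqxx orbT.
Qed.

Lemma adjacent_attach_max i :
  Defs.adjacent (attach G W) (old_node i) ord_max = (i \in W).
Proof.
rewrite /Defs.adjacent /= inE; case: imsetP => [[e _ eE]|_] /=.
  by have := max_notin_old_imset e; rewrite -eE !inE eqxx orbT.
apply/imsetP/idP => [[k kW /setP/(_ (old_node i))]|iW]; last by exists i.
rewrite !inE eqxx (negPf (old_node_neq_max i)) !orbF.
by move/esym/eqP/old_node_inj->.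
Qed.

Lemma degree_attach_old i :
  degree (attach G W) (old_node i) = (degree G i + (i \in W))%N.
Proof.
rewrite /degree (finset.cardsD1 ord_max) inE adjacent_attach_max addnC.
congr (_ + _)%N; rewrite -(card_imset _ old_node_inj).
apply: eq_card => u; rewrite !inE; apply/andP/imsetP.
  move=> [/old_or_max[j ->]]; rewrite adjacent_attach_old => ij.
  by exists j; rewrite ?inE.
by move=> [j + ->]; rewrite inE old_node_neq_max adjacent_attach_old.
Qed.

Lemma triangle_attach_imset i A :
  [&& old_node i \in (@old_node n @: A)%SET,
      #|(@old_node n @: A)%SET| == 3%N &
      [forall u in (@old_node n @: A)%SET, forall v in (@old_node n @: A)%SET,
         (u != v) ==> Defs.adjacent (attach G W) u v]] =
  [&& i \in A, #|A| == 3%N &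
      [forall j in A, forall k in A, (j != k) ==> Defs.adjacent G j k]].
Proof.
rewrite (mem_imset _ _ old_node_inj) (card_imset _ old_node_inj).
congr [&& _, _ & _]; apply/forall_inP/forall_inP => clique.
  move=> j jA; apply/forall_inP => k kA.
  move/forall_inP: (clique _ (imset_f (@old_node n) jA)).
  move=> /(_ _ (imset_f (@old_node n) kA)).
  by rewrite (inj_eq old_node_inj) adjacent_attach_old.
move=> _ /imsetP[j jA ->]; apply/forall_inP => _ /imsetP[k kA ->].
rewrite (inj_eq old_node_inj) adjacent_attach_old.
by move/forall_inP: (clique _ jA) => /(_ _ kA).
Qed.

Lemma triangles_attach_ge i :
  (triangles G i <= triangles (attach G W) (old_node i))%N.
Proof.
rewrite /triangles -(card_imset _ (imset_inj old_node_inj)).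
apply/subset_leq_card/fintype.subsetP => _ /imsetP[A + ->].
by rewrite !inE triangle_attach_imset.
Qed.

Lemma triangles_attach_notin i :
  i \notin W -> triangles (attach G W) (old_node i) = triangles G i.
Proof.
move=> iW; apply/eqP; rewrite eqn_leq triangles_attach_ge andbT.
rewrite /triangles -[X in (_ <= X)%N](card_imset _ (imset_inj old_node_inj)).
apply/subset_leq_card/fintype.subsetP => T; rewrite inE => Ttri.
have maxT : ord_max \notin T.
  case/and3P: Ttri => iT _ /forall_inP/(_ _ iT)/forall_inP clique.
  apply/negP => /clique.
  by rewrite old_node_neq_max adjacent_attach_max (negPf iW).
have TE : T = (@old_node n @: (@old_node n @^-1: T))%SET.
  apply/setP => u; apply/idP/imsetP => [uT|[j + ->]]; last by rewrite inE.
  have /old_or_max[j uE] : u != ord_max by apply: contraNneq maxT => <-.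
  by exists j; rewrite // inE -uE.
by rewrite TE; apply: imset_f; rewrite inE -triangle_attach_imset -TE.
Qed.

Variable R : realType.

Lemma clustering_attach_notin i :
  i \notin W -> clustering R (attach G W) (old_node i) = clustering R G i.
Proof.
move=> iW; rewrite /clustering degree_attach_old triangles_attach_notin //.
by rewrite (negPf iW) addn0.
Qed.

Lemma clustering_attach_drop i :
  clustering R G i - clustering R (attach G W) (old_node i) <= 2 / 3.
Proof.
have [iW|iW] := boolP (i \in W); last first.
  by rewrite clustering_attach_notin // subrr.
have := clustering_le1 R G i; have := clustering_ge0 R (attach G W) (old_node i).
rewrite /clustering degree_attach_old iW addn1.
have := triangles_attach_ge i; rewrite -(ler_nat R).
set D := (triangles G i)%:R; set D' := (triangles _ _)%:R => DD'.
case: (ltnP (degree G i) 2) => k2; first by lra.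
have k2R : 2 <= (degree G i)%:R :> R by rewrite ler_nat.
rewrite ltnNge (leqW k2) /= -[(degree G i).+1%:R]natr1 addrK.
set k := (degree G i)%:R in k2R *; set c := 2 * D / _ => _ c1.
have -> : 2 * D' / ((k + 1) * k) =
    c * ((k - 1) / (k + 1)) + 2 * (D' - D) / ((k + 1) * k).
  by rewrite /c; field; lra.
have ge0 : 0 <= 2 * (D' - D) / ((k + 1) * k).
  by rewrite divr_ge0 // mulr_ge0 //; lra.
suff : c - c * ((k - 1) / (k + 1)) <= 2 / 3 by lra.
have -> : c - c * ((k - 1) / (k + 1)) = c * (2 / (k + 1)) by field; lra.
apply: (@le_trans _ _ (1 * (2 / (k + 1)))).
  by rewrite ler_wpM2r // divr_ge0 //; lra.
by rewrite mul1r ler_pM2l // lef_pV2 // ?posrE; lra.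
Qed.

Lemma clustering_attach_gain i :
  clustering R (attach G W) (old_node i) - clustering R G i <= 1.
Proof.
have := clustering_le1 R (attach G W) (old_node i).
by have := clustering_ge0 R G i; lra.
Qed.

Lemma sum_clustering_attach :
  - (#|W|%:R + 1) <=
    \sum_(i < n) clustering R G i - \sum_(u < n.+1) clustering R (attach G W) u
  <= #|W|%:R * (2 / 3).
Proof.
have c0 := clustering_ge0 R (attach G W) ord_max.
have c1 := clustering_le1 R (attach G W) ord_max.
rewrite big_ord_recr /= [- (\sum_(_ < _) _ + _)]opprD addrA -sumrB.
set s := \sum_(i < n) _.
have -> : s = \sum_(i in W)
    (clustering R G i - clustering R (attach G W) (old_node i)).
  rewrite /s (bigID (mem W)) /= [X in _ + X]big1 ?addr0 // => i iW.
  by rewrite -/(old_node i) clustering_attach_notin // subrr.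
set r := \sum_(i in W) _.
have r_le : r <= #|W|%:R * (2 / 3).
  rewrite mulr_natl -sumr_const.
  by apply: ler_sum => i _; exact: clustering_attach_drop.
have r_ge : - #|W|%:R <= r.
  rewrite -sumr_const -sumrN.
  by apply: ler_sum => i _; have := clustering_attach_gain i; lra.
by apply/andP; split; lra.
Qed.

Lemma avg_clustering_attach :
  - ((#|W|%:R + 1) / n.+1%:R) <=
    avg_clustering R G - avg_clustering R (attach G W)
  <= (#|W|%:R * (2 / 3) + 1) / n.+1%:R.
Proof.
have avg0 := avg_clustering_ge0 R G; have avg1 := avg_clustering_le1 R G.
have sumE : \sum_(i < n) clustering R G i = n%:R * avg_clustering R G.
  rewrite /avg_clustering; have [n0|n_neq0] := eqVneq n 0%N; last first.
    by rewrite mulrC divfK // pnatr_eq0.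
  rewrite big1 ?mul0r ?mulr0 // => i _.
  by have := ltn_ord i; rewrite [X in (_ < X)%N]n0 ltn0.
have := sum_clustering_attach; rewrite sumE => /andP[lo hi].
have -> : avg_clustering R G - avg_clustering R (attach G W) =
    (n%:R * avg_clustering R G + avg_clustering R G -
      \sum_(u < n.+1) clustering R (attach G W) u) / n.+1%:R.
  have n1 : n.+1%:R != 0 :> R by rewrite pnatr_eq0.
  rewrite [avg_clustering R (attach G W)]/avg_clustering [RHS]mulrBl.
  by rewrite -[X in _ = (_ + X) / _ - _]mul1r -mulrDl natr1 mulrAC divff ?mul1r.
rewrite -mulNr !ler_pM2r ?invr_gt0 ?ltr0n //.
by apply/andP; split; lra.
Qed.

End Attach.

Theorem proposition2 (R : realType) (d : measure_display)
    (Omega : measurableType d) (P : probability Omega R)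
    (alpha eps : R) (n0 : nat) (G0 : sgraph n0)
    (G : graph_process Omega n0) (X Y : node_process Omega n0)
    (alpha_ge0 : 0 <= alpha) (eps_ge0 : 0 <= eps)
    (G0_init : CA_initial eps G0)
    (G_CA : CA_model P alpha eps G0 G X Y)
    (t : nat) (w : Omega) :
  - (3 / (n0 + t + 1)%:R) <= avg_clustering R (G t w) - avg_clustering R (G t.+1 w)
    <= (7 / 3) / (n0 + t + 1)%:R.
Proof.
rewrite (CA_step G_CA).
have := avg_clustering_attach (G t w) [set X t w; Y t w]%SET R.
rewrite cards2 (CA_distinct G_CA) addn1 [(n0 + t)%N]addnC.
have -> : 2%:R + 1 = 3 :> R by lra.
by have -> : 2%:R * (2 / 3) + 1 = 7 / 3 :> R by lra.
Qed.
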